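(* For the cycle $C_n$ on $n\ge 3$ vertices, $$\tau_{K_3}(C_n)=\begin{cases}0, & n=3,\\ 1, & n=4,\\ 2, & n=5,\\ 1, & n\ge 6.\end{cases}$$
   Context: All graphs are finite and simple. A matching is a set of pairwise vertex-disjoint edges; $V(M)$ denotes the set of endpoints of the edges of $M$. Degree-preserving Builder--Chooser game started from a graph $G_0$: it is played in rounds $t=1,2,\dots$. In round $t$ the current graph is $G_{t-1}=(V,E)$. (i) Builder chooses a matching $M\subseteq E$ and forms the intermediate graph $G^+$ by deleting the edges of $M$, adding a new vertex $w$, and joining $w$ to every vertex of $V(M)$ (a DPG step). (ii) Builder chooses a partition of $E(G^+)$ into two disjoint sets $E^{(0)}\sqcup E^{(1)}$. (iii) Chooser selects $i\in\{0,1\}$, and $G_t:=(V(G^+),E^{(i)})$. For graphs $H$ and $G_0$, the forcing time $\tau_H(G_0)$ is the least $T\ge 0$ such that Builder has a strategy in the game started from $G_0$ guaranteeing that $G_t$ contains $H$ as a (not necessarily induced) subgraph for some $0\le t\le T$; $\tau_H(G_0)=\infty$ if there is no such $T$, i.e. if Chooser can avoid $H$ forever. *)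

(* Defs.v *)
From HB Require Import structures.
From mathcomp Require Import all_boot boolp.
Set Implicit Arguments.
Unset Strict Implicit.
Unset Printing Implicit Defensive.

Record sgraph := SGraph {
  vertex :> finType;
  edges : {set {set vertex}};
  edges_card2 : forall e, e \in edges -> #|e| = 2
}.

Definition subgraph (H G : sgraph) : Prop :=
  exists2 f : H -> G, injective f & forall e, e \in edges H -> f @: e \in edges G.

Lemma complete_card2 n (e : {set 'I_n}) : e \in [set e : {set 'I_n} | #|e| == 2] -> #|e| = 2.
Proof. by rewrite inE => /eqP. Qed.

Definition complete_graph (n : nat) : sgraph := SGraph (@complete_card2 n).

(* [ordS i] is the cyclic successor of [i] in ['I_n]. *)
Definition cycle_edges (n : nat) : {set {set 'I_n}} :=
  [set [set i; ordS i] | i : 'I_n].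

Lemma cycle_card2 n (n_ge3 : 3 <= n) (e : {set 'I_n}) :
  e \in cycle_edges n -> #|e| = 2.
Proof.
case/imsetP=> i _ ->; rewrite cards2.
suff -> : i != ordS i by [].
rewrite -val_eqE /=; have := ltn_ord i; rewrite leq_eqVlt => /orP[/eqP iE|lt_in].
  by rewrite iE modnn; case: (nat_of_ord i) iE n_ge3 => // <-.
by rewrite modn_small // neq_ltn ltnSn.
Qed.

Definition cycle_graph (n : nat) (n_ge3 : 3 <= n) : sgraph :=
  SGraph (cycle_card2 n_ge3).

Definition is_matching (G : sgraph) (M : {set {set G}}) : Prop :=
  M \subset edges G /\ trivIset M.

(* The new vertex w is [None], and [cover M] is V(M). *)
Definition dpg_edges (G : sgraph) (M : {set {set G}}) : {set {set option G}} :=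
  [set Some @: (e : {set G}) | e in edges G :\: M]
    :|: [set [set None; Some v] | v in cover M].

Lemma dpg_card2 (G : sgraph) (M : {set {set G}}) e :
  e \in dpg_edges M -> #|e| = 2.
Proof.
case/setUP=> /imsetP[x xP ->]; last by rewrite cards2.
rewrite card_imset; last exact: Some_inj.
by case/setDP: xP => /edges_card2.
Qed.

(* A round of Builder: the classes E^(0) and E^(1) are [part false] and
   [part true]. *)
Record move (G : sgraph) := Move {
  matching : {set {set G}};
  part : bool -> {set {set option G}};
  matchingP : is_matching matching;
  part_cover : part false :|: part true = dpg_edges matching;
  part_disjoint : [disjoint part false & part true]
}.

Lemma part_card2 (G : sgraph) (m : move G) i e : e \in part m i -> #|e| = 2.
Proof.
move=> eP; apply: (@dpg_card2 G (matching m)); rewrite -part_cover inE.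
by case: i eP => ->; rewrite ?orbT.
Qed.

Definition play_round (G : sgraph) (m : move G) (i : bool) : sgraph :=
  SGraph (@part_card2 G m i).

(* A Builder strategy sees all previous choices of Chooser and the current
   graph; once the initial graph and the strategy are fixed, the previous
   choices of Chooser determine the whole history of the game. *)
Definition strategy := seq bool -> forall G : sgraph, move G.

Fixpoint play (s : strategy) (G0 : sgraph) (c : nat -> bool) (t : nat) : sgraph :=
  if t is t'.+1 then
    let G := play s G0 c t' in play_round (s (mkseq c t') G) (c t')
  else G0.

Definition can_force (H G0 : sgraph) (T : nat) : Prop :=
  exists s : strategy, forall c : nat -> bool,
    exists2 t, t <= T & subgraph H (play s G0 c t).

(* [None] stands for infinity. *)
Definition forcing_time (H G0 : sgraph) : option nat :=
  if pselect (exists T, `[< can_force H G0 T >]) is left forceable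
  then Some (ex_minn forceable) else None.

(* Main.v *)
Require Import Defs.
From mathcomp Require Import all_boot.
From mathcomp Require Import boolp zify.

Set Implicit Arguments.
Unset Strict Implicit.
Unset Printing Implicit Defensive.

(** A round played on a matching covering two disjoint edges it does not
   contain creates two edge-disjoint triangles through the new vertex, and
   Builder puts them in different classes.  In C_4 and, for n >= 6, in C_n such
   a matching exists.  In C_5, deleting two edges creates one triangle
   and an edge-disjoint 4-cycle through the new vertex, so two rounds suffice.
   One round does not: two edge-disjoint triangles would come from two disjoint
   edges of C_5 off the matching M, whose neighbouring edges must then all
   belong to M, although two of these are adjacent. *)

(** * Triangles in simple graphs *)

Lemma imset_set2 (aT rT : finType) (f : aT -> rT) x y :
  f @: [set x; y] = [set f x; f y].
Proof. by rewrite imsetU1 imset_set1. Qed.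

Lemma edge_neq (G : sgraph) (x y : G) : [set x; y] \in edges G -> x != y.
Proof. by move/edges_card2; rewrite cards2; case: (x != y). Qed.

(** Edges have two elements, so pairwise adjacency already makes the three vertices distinct and
    injectivity of the embedding comes for free. *)
Lemma subgraph_K3P (G : sgraph) :
  subgraph (complete_graph 3) G <->
  exists a b c : G,
    [/\ [set a; b] \in edges G, [set a; c] \in edges G & [set b; c] \in edges G].
Proof.
split=> [[f _ fE]|[a [b [c [ab ac bc]]]]].
  pose o k : 'I_3 := inord k.
  exists (f (o 0)), (f (o 1)), (f (o 2)).
  by split; rewrite -imset_set2 fE // inE cards2 -val_eqE /= !inordK.
have := (edge_neq ab, edge_neq ac, edge_neq bc) => -[[nab nac] nbc].
exists (tnth [tuple a; b; c]).
  by apply/tuple_uniqP; rewrite /= !inE negb_or nab nac nbc.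
move=> e; rewrite inE => /cards2P[i [j [ij ->]]]; rewrite imset_set2.
case: i j ij => [[|[|[|//]]] ?] [[|[|[|//]]] ?] //= _; rewrite /tnth /= //;
  by rewrite setUC.
Qed.

(** * Winning positions and the forcing time *)

Section Game.

Variable H : sgraph.

(** Backward-induction form of the game: Builder's moves and Chooser's answers appear as alternating
    quantifiers, with no strategy object. *)
Fixpoint wins (T : nat) (G : sgraph) : Prop :=
  subgraph H G \/
  if T is T'.+1 then exists m : move G, forall i, wins T' (play_round m i)
  else False.

Section SplitMove.

Variables (G : sgraph) (M : {set {set G}}) (P : {set {set option G}}).
Hypothesis M_matching : is_matching M.

(** Any set [P] of vertex sets encodes a partition, so Builder's classes can be given by a property
    of edges without checking that [P] consists of edges. *)
Let split_part (i : bool) := [set e in dpg_edges M | (e \in P) == i].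

Let split_cover : split_part false :|: split_part true = dpg_edges M.
Proof. by apply/setP=> e; rewrite !inE -andb_orr; case: (e \in P); rewrite andbT. Qed.

Let split_disjoint : [disjoint split_part false & split_part true].
Proof.
by apply/pred0P=> e /=; rewrite !inE; case: (e \in P); rewrite !andbF.
Qed.

Definition split_move : move G := Move M_matching split_cover split_disjoint.

Lemma mem_split_move i e :
  (e \in edges (play_round split_move i)) = (e \in dpg_edges M) && ((e \in P) == i).
Proof. by rewrite inE. Qed.

End SplitMove.

Lemma set0_matching (G : sgraph) : @is_matching G set0.
Proof. by split; [exact: sub0set | apply/trivIsetP=> A B; rewrite inE]. Qed.

(** Default answer of a strategy, which must be defined at losing positions too. *)
Definition idle_move (G : sgraph) : move G := split_move set0 (set0_matching G).

Lemma wins_can_force T G : wins T G -> can_force H G T.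
Proof.
move=> winG.
(* The history serves only as a clock: [(T - size h).-1] rounds remain after the coming move. *)
pose good (h : seq bool) G m := forall i, wins (T - size h).-1 (@play_round G m i).
pose s : strategy := fun h G =>
  if pselect (exists m : move G, good h G m) is left ex then projT1 (cid ex)
  else idle_move G.
have sP h G' : (exists m : move G', good h G' m) -> good h G' (s h G').
  by move=> ex; rewrite /s; case: pselect => // ex'; exact: projT2 (cid ex').
exists s => c.
(* Up to time [t], either [H] has appeared or the position is won within the remaining [T - t]
   rounds; at [t = T] the latter also means that [H] is present. *)
suff inv t : t <= T -> (exists2 u, u <= t & subgraph H (play s G c u))
                       \/ wins (T - t) (play s G c t).
  have [//|//|] := inv T; rewrite subnn => -[HG|//].
  by exists T.
elim: t => [_|t IH tT]; first by right; rewrite subn0.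
have [[u ut uH]|] := IH (ltnW tT); first by left; exists u => //; exact: leqW.
have -> : T - t = (T - t.+1).+1 by lia.
move=> [HG|ex]; first by left; exists t.
right=> /=; have : good (mkseq c t) _ (s (mkseq c t) (play s G c t)).
  by apply: sP; case: ex => m mE; exists m => i; rewrite size_mkseq -subnS; exact: mE.
by move/(_ (c t)); rewrite size_mkseq -subnS.
Qed.

Lemma can_force1 G T : can_force H G T -> T <= 1 ->
  subgraph H G \/ exists m : move G, forall i, subgraph H (play_round m i).
Proof.
move=> [s sP] T1; have [HG|nHG] := pselect (subgraph H G); [by left|right].
(* Against the Chooser who always answers [i], success at time 0 is excluded, so it occurs in the
   graph left by the first move. *)
exists (s [::] G) => i; have [[//|[|t]] tT] := sP (fun=> i); first by [].
by move: (leq_trans tT T1).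
Qed.

Lemma can_force0 G : can_force H G 0 -> subgraph H G.
Proof. by case=> s /(_ xpredT)[[|//]]. Qed.

Lemma forcing_timeE G T :
  can_force H G T -> (forall T', can_force H G T' -> T <= T') ->
  forcing_time H G = Some T.
Proof.
move=> GT minT; rewrite /forcing_time; case: pselect => [ex|[]]; last first.
  by exists T; apply/asboolP.
congr Some; case: ex_minnP => k /asboolP kP kmin.
by apply/eqP; rewrite eqn_leq minT // kmin //; apply/asboolP.
Qed.

End Game.

(** * Edges after a DPG step, and matchings built edge by edge *)

Lemma mem_dpg_Some (G : sgraph) (M : {set {set G}}) x y :
  ([set Some x; Some y] \in dpg_edges M) = ([set x; y] \in edges G :\: M).
Proof.
rewrite -imset_set2 in_setU mem_imset; last exact/imset_inj/Some_inj.
rewrite [X in _ || X](_ : _ = false) ?orbF //.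
apply/negP=> /imsetP[v _ /setP/(_ None)]; rewrite !inE eqxx.
by move/imsetP=> [].
Qed.

Lemma mem_dpg_None (G : sgraph) (M : {set {set G}}) v :
  ([set None; Some v] \in dpg_edges M) = (v \in cover M).
Proof.
apply/setUP/idP => [[/imsetP[e _]|/imsetP[u uM]]|vM]; last by right; exact: imset_f.
  by move/setP/(_ None); rewrite !inE eqxx => /esym/imsetP[].
by move/setP/(_ (Some v)); rewrite !inE eqxx /= => /esym/eqP[->].
Qed.

Lemma cover_setU1 (T : finType) (A : {set T}) (M : {set {set T}}) :
  cover (A |: M) = A :|: cover M.
Proof. by rewrite /cover bigcup_setU big_set1. Qed.

Lemma matching_setU1 (G : sgraph) (M : {set {set G}}) a b : is_matching M ->
  [set a; b] \in edges G -> a \notin cover M -> b \notin cover M ->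
  is_matching ([set a; b] |: M).
Proof.
move=> [ME Mtriv] ab aM bM; split; first by rewrite subUset sub1set ab.
apply: trivIsetU => //; first exact: trivIset1.
rewrite /cover big_set1 -/(cover M); apply/pred0P=> v /=; rewrite !inE.
by apply/negP=> /andP[/orP[]/eqP->]; apply/negP.
Qed.

Lemma cover_set0 (T : finType) : cover (set0 : {set {set T}}) = set0.
Proof. by rewrite /cover big_set0. Qed.

Lemma triangle_play_round (G : sgraph) (m : move G) i a b :
  [set None; Some a] \in part m i -> [set None; Some b] \in part m i ->
  [set Some a; Some b] \in part m i -> subgraph (complete_graph 3) (play_round m i).
Proof. by move=> wa wb ab; apply/subgraph_K3P; exists None, (Some a), (Some b). Qed.

(** * Builder's wins in one and two rounds *)

Lemma wins_two_triangles (G : sgraph) (M : {set {set G}}) (a b c d : G) :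
  is_matching M -> uniq [:: a; b; c; d] ->
  [set a; b] \in edges G :\: M -> [set c; d] \in edges G :\: M ->
  {subset [:: a; b; c; d] <= cover M} -> wins (complete_graph 3) 1 G.
Proof.
move=> Mm abcd ab cd sM; right.
have {sM}[aM bM cM dM] :
    [/\ a \in cover M, b \in cover M, c \in cover M & d \in cover M].
  by split; apply: sM; rewrite !inE eqxx ?orbT.
(* Class [true] takes every edge meeting [c] or [d]; as the four vertices are distinct, the triangle
   on [None], [a], [b] stays whole in class [false]. *)
exists (split_move [set e : {set option G} | (Some c \in e) || (Some d \in e)] Mm) => i; left.
move: abcd; rewrite /= !inE !negb_or andbT => /and3P[/and3P[_ ac ad] /andP[bc bd] _].
case: i; [apply: (triangle_play_round (a := c) (b := d))
         |apply: (triangle_play_round (a := a) (b := b))];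
  rewrite mem_split_move ?mem_dpg_None ?mem_dpg_Some ?aM ?bM ?cM ?dM ?ab ?cd /=;
  rewrite !inE ?eqxx ?orbT //= !(inj_eq Some_inj);
  by rewrite ?(eq_sym c) ?(eq_sym d) ?(negPf ac) ?(negPf ad) ?(negPf bc) ?(negPf bd).
Qed.

Lemma eq_set2 (T : finType) (a b c d : T) :
  ([set a; b] == [set c; d]) = ((a == c) && (b == d)) || ((a == d) && (b == c)).
Proof.
apply/eqP/orP => [E|[]/andP[/eqP-> /eqP->] //]; last exact: setUC.
have := (set21 a b, set22 a b); rewrite E => -[/set2P aE /set2P bE].
have := (set21 c d, set22 c d); rewrite -E => -[/set2P cE /set2P dE].
by case: aE bE cE dE => [] ? [] ? [] ? [] ?; subst; rewrite !eqxx; auto.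
Qed.

(** Splits [U] into pairwise inequalities and rewrites with them, so that comparisons of two-element
    sets evaluate. *)
Ltac use_uniq U :=
  rewrite ?inE ?eq_set2; move: U;
  rewrite /= !inE !negb_or -?andbA => U;
  repeat match goal with H : is_true (_ && _) |- _ => case/andP: H => ? ? end;
  repeat match goal with H : is_true (?x != ?y) |- _ =>
    rewrite ?(eq_sym y x) ?(negPf H) {H} end;
  rewrite ?eqxx ?orbT ?andbF //.

Lemma wins_C4 (G : sgraph) (a b c d : G) : uniq [:: a; b; c; d] ->
  [set a; b] \in edges G -> [set b; c] \in edges G ->
  [set c; d] \in edges G -> [set d; a] \in edges G ->
  wins (complete_graph 3) 1 G.
Proof.
move=> U ab bc cd da.
apply: (@wins_two_triangles _ ([set a; b] |: ([set c; d] |: set0)) b c d a).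
- apply: matching_setU1; rewrite ?cover_setU1 ?cover_set0 //; try by use_uniq U.
  by apply: matching_setU1; rewrite ?cover_set0 ?inE //; exact: set0_matching.
- by rewrite -(rot_uniq 3).
- by rewrite in_setD bc; use_uniq U.
- by rewrite in_setD da; use_uniq U.
- by move=> x; rewrite !cover_setU1 !inE => /or4P[]/eqP->; rewrite eqxx ?orbT.
Qed.

(** The first, third and fifth edges of the path form the matching and cover the disjoint edges [bc]
    and [de]. Every C_n with n >= 6 contains such a path. *)
Lemma wins_P6 (G : sgraph) (a b c d e f : G) : uniq [:: a; b; c; d; e; f] ->
  [set a; b] \in edges G -> [set b; c] \in edges G ->
  [set c; d] \in edges G -> [set d; e] \in edges G ->
  [set e; f] \in edges G -> wins (complete_graph 3) 1 G.
Proof.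
move=> U ab bc cd de ef.
apply: (@wins_two_triangles _ ([set a; b] |: ([set c; d] |: ([set e; f] |: set0))) b c d e).
- apply: matching_setU1; rewrite ?cover_setU1 ?cover_set0 //; try by use_uniq U.
  apply: matching_setU1; rewrite ?cover_setU1 ?cover_set0 //; try by use_uniq U.
  by apply: matching_setU1; rewrite ?cover_set0 ?inE //; exact: set0_matching.
- by use_uniq U.
- by rewrite in_setD bc; use_uniq U.
- by rewrite in_setD de; use_uniq U.
- by move=> x; rewrite !cover_setU1 !inE => /or4P[]/eqP->; rewrite eqxx ?orbT.
Qed.

Lemma wins_C5 (G : sgraph) (a b c d e : G) : uniq [:: a; b; c; d; e] ->
  [set a; b] \in edges G -> [set b; c] \in edges G ->
  [set c; d] \in edges G -> [set d; e] \in edges G ->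
  [set e; a] \in edges G -> wins (complete_graph 3) 2 G.
Proof.
move=> U ab bc cd de ea; right.
pose M := [set a; b] |: ([set c; d] |: set0).
have Mm : is_matching M.
  apply: matching_setU1; rewrite ?cover_setU1 ?cover_set0 //; try by use_uniq U.
  by apply: matching_setU1; rewrite ?cover_set0 ?inE //; exact: set0_matching.
have [[aM bM] [cM dM]] :
    (a \in cover M /\ b \in cover M) /\ (c \in cover M /\ d \in cover M).
  by rewrite !cover_setU1 !inE !eqxx ?orbT.
have bcM : [set b; c] \in edges G :\: M by rewrite in_setD bc; use_uniq U.
have deM : [set d; e] \in edges G :\: M by rewrite in_setD de; use_uniq U.
have eaM : [set e; a] \in edges G :\: M by rewrite in_setD ea; use_uniq U.
(* Class [true] contains the triangle on [None], [b], [c]; class [false] keeps the 4-cycle [None],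
   [d], [e], [a], which is won in one more round. *)
exists (split_move [set x : {set option G} | (Some b \in x) || (Some c \in x)] Mm).
case; [left; apply: (triangle_play_round (a := b) (b := c))
      |apply: (@wins_C4 (play_round _ false) None (Some d) (Some e) (Some a))];
  rewrite ?(setUC [set Some a] [set None]) ?mem_split_move
    ?mem_dpg_None ?mem_dpg_Some ?bM ?cM ?aM ?dM ?bcM ?deM ?eaM;
  by rewrite /= ?inE ?(inj_eq Some_inj); use_uniq U.
Qed.

(** * Adjacency in the cycle *)

Section Cycle.

Variables (n : nat) (n_ge3 : 3 <= n).
Let C := cycle_graph n_ge3.

Lemma mem_cycle_edges (x y : 'I_n) :
  ([set x; y] \in cycle_edges n) = (y == ordS x) || (x == ordS y).
Proof.
apply/imsetP/orP => [[i _ /eqP]|[]/eqP->].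
- by rewrite eq_set2 => /orP[]/andP[/eqP-> /eqP->]; [left|right].
- by exists x.
- by exists y; rewrite // setUC.
Qed.

Lemma val_ordS (x : 'I_n) : val (ordS x) = if x.+1 == n then 0 else x.+1.
Proof.
rewrite /=; case: eqP => [->|/eqP xn]; first by rewrite modnn.
by rewrite modn_small // ltn_neqAle xn ltn_ord.
Qed.

(** Around a triangle three steps of +1 or -1 sum to an odd number of absolute value at most 3,
    which n >= 3 divides only if n = 3. *)
Lemma cycle_triangle_free : n != 3 -> ~ subgraph (complete_graph 3) C.
Proof.
move=> n3 /subgraph_K3P[a [b [c]]] []; rewrite !mem_cycle_edges -!val_eqE !val_ordS.
have := (ltn_ord a, ltn_ord b, ltn_ord c) => -[[]].
rewrite /=; do 3!case: ifP => ?; lia.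
Qed.

Lemma cycle_edge (i j : 'I_n) : j = i.+1 :> nat -> [set i; j] \in edges C.
Proof.
move=> ji; rewrite mem_cycle_edges -val_eqE val_ordS -ji.
by rewrite (ltn_eqF (ltn_ord j)) eqxx.
Qed.

Lemma cycle_last_edge (i j : 'I_n) : i.+1 = n -> j = 0 :> nat -> [set i; j] \in edges C.
Proof. by move=> ni j0; rewrite mem_cycle_edges -val_eqE val_ordS ni eqxx /= j0. Qed.

End Cycle.

(** * One round does not suffice on the 5-cycle *)

Lemma triangle_free_play_round (G : sgraph) (m : move G) i :
  ~ subgraph (complete_graph 3) G -> subgraph (complete_graph 3) (play_round m i) ->
  exists x y, [/\ [set x; y] \in edges G :\: matching m,
    x \in cover (matching m), y \in cover (matching m),
    [set None; Some x] \in part m i & [set None; Some y] \in part m i].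
Proof.
move=> nG /subgraph_K3P[a [b [c [/= ab ac bc]]]].
have sub e : e \in part m i -> e \in dpg_edges (matching m).
  by rewrite -part_cover inE; clear; case: i => ->; rewrite ?orbT.
have old u v : [set Some u; Some v] \in part m i ->
    [set u; v] \in edges G :\: matching m.
  by move/sub; rewrite mem_dpg_Some.
have new u v : [set None; Some u] \in part m i -> [set None; Some v] \in part m i ->
    [set Some u; Some v] \in part m i ->
    exists x y, [/\ [set x; y] \in edges G :\: matching m,
      x \in cover (matching m), y \in cover (matching m),
      [set None; Some x] \in part m i & [set None; Some y] \in part m i].
  move=> wu wv uv; exists u, v; split=> //; first exact: old.
  - by move: (sub _ wu); rewrite mem_dpg_None.
  - by move: (sub _ wv); rewrite mem_dpg_None.
have N0 : [set None; None] \notin part m i.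
  by apply/negP=> /part_card2; rewrite cards2 eqxx.
(* A triangle with two corners at [None] would need a loop, and one avoiding [None] would already
   lie in [G]; so exactly one corner is [None]. *)
case: a b c ab ac bc => [a|] [b|] [c|] ab ac bc;
  try by rewrite (negPf N0) in ab ac bc.
- case: nG; apply/subgraph_K3P; exists a, b, c.
  move: (old _ _ ab) (old _ _ ac) (old _ _ bc); rewrite !inE.
  by move=> /andP[_ ->] /andP[_ ->] /andP[_ ->].
- by apply: new ab; rewrite setUC.
- by apply: new ac; rewrite // setUC.
- exact: new bc.
Qed.

(** The 5-cycle has diameter 2. Applied to the first endpoints of two edges, this decides whether
    the edges meet. *)
Lemma ord5_cases (x y : 'I_5) :
  [\/ y = x, ordS x = y \/ x = ordS y, y = ordS (ordS x) | x = ordS (ordS y)].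
Proof.
case: x y => [[|[|[|[|[|//]]]]] ?] [[|[|[|[|[|//]]]]] ?];
  first [by constructor 1; apply: val_inj | by constructor 2; left; apply: val_inj
  | by constructor 2; right; apply: val_inj | by constructor 3; apply: val_inj
  | by constructor 4; apply: val_inj].
Qed.

Lemma C5_not_forced (m : move (@cycle_graph 5 isT)) :
  ~ forall i, subgraph (complete_graph 3) (play_round m i).
Proof.
move=> win; have tf := @cycle_triangle_free 5 isT isT.
(* The old edge of the triangle in class [i], oriented along the cycle. *)
have edge i : exists x : 'I_5, [/\ [set x; ordS x] \notin matching m,
    x \in cover (matching m), ordS x \in cover (matching m),
    [set None; Some x] \in part m i & [set None; Some (ordS x)] \in part m i].
  have [x [y [/setDP[xyE xyM] xM yM xP yP]]] := triangle_free_play_round tf (win i).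
  move: xyE xyM; rewrite mem_cycle_edges => /orP[]/eqP E; rewrite E => xyM.
    by exists x; rewrite -E; rewrite -E in xyM.
  by exists y; rewrite -E; rewrite setUC -E in xyM.
have [ME Mtriv] := matchingP m.
have M_edge e v : e \in matching m -> v \in e ->
    exists2 x : 'I_5, e = [set x; ordS x] & (v == x) || (v == ordS x).
  move=> eM; have /imsetP[x _ ->] := subsetP ME _ eM.
  by rewrite !inE => vx; exists x.
(* A covered endpoint of an edge off the matching must be covered by its other cycle edge. *)
have before (x : 'I_5) : [set x; ordS x] \notin matching m ->
    x \in cover (matching m) -> [set ord_pred x; x] \in matching m.
  move=> nx /bigcupP[e eM xe]; have [y eE] := M_edge _ _ eM xe.
  case/orP=> /eqP xy; first by rewrite xy -eE eM in nx.
  by rewrite xy ordSK -eE.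
have after (x : 'I_5) : [set x; ordS x] \notin matching m ->
    ordS x \in cover (matching m) -> [set ordS x; ordS (ordS x)] \in matching m.
  move=> nx /bigcupP[e eM xe]; have [y eE] := M_edge _ _ eM xe.
  case/orP=> /eqP xy; first by rewrite xy -eE.
  by rewrite (can_inj (@ordSK 5) xy) -eE eM in nx.
have adjacent (x : 'I_5) : [set x; ordS x] \in matching m ->
    [set ordS x; ordS (ordS x)] \in matching m -> False.
  move=> xM yM; have /trivIsetP/(_ _ _ xM yM) := Mtriv.
  have -> : [set x; ordS x] != [set ordS x; ordS (ordS x)].
    by rewrite eq_set2; case: x {xM yM} => [[|[|[|[|[|//]]]]] ?].
  by move/(_ isT)/pred0P/(_ (ordS x)); rewrite /= !inE !eqxx orbT.
have disj e : e \in part m false -> e \in part m true -> False.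
  by move=> e0 e1; have /pred0P/(_ e) := part_disjoint m; rewrite /= e0 e1.
(* Here the matching contains the edge after [ordS y] and the edge before [x]; they share a vertex
   because x + 4 = x - 1 modulo 5. *)
have far (x y : 'I_5) : y = ordS (ordS x) ->
    [set x; ordS x] \notin matching m -> x \in cover (matching m) ->
    [set y; ordS y] \notin matching m -> ordS y \in cover (matching m) -> False.
  move=> yE nx xM ny yM; apply: adjacent (after _ ny yM) _.
  have -> : ordS (ordS y) = ord_pred x.
    by apply: val_inj; rewrite yE; case: x {yE nx xM} => [[|[|[|[|[|//]]]]] ?].
  by rewrite ord_predK before.
have [x [nx xM sxM xP sxP]] := edge false.
have [y [ny yM syM yP syP]] := edge true.
(* In the first three cases the two old edges share a vertex, whose edge to [None] would lie in both
   classes. *)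
have [yx|[sxy|xsy]|yE|xE] : [\/ y = x, ordS x = y \/ x = ordS y,
    y = ordS (ordS x) | x = ordS (ordS y)].
- exact: ord5_cases.
- by subst y; apply: disj xP yP.
- by subst y; apply: disj sxP yP.
- by subst x; apply: disj xP syP.
- exact: far yE nx xM ny syM.
- exact: far xE ny yM nx sxM.
Qed.

Theorem theorem3p3 (n : nat) (n_ge3 : 3 <= n) :
  forcing_time (complete_graph 3) (cycle_graph n_ge3) =
    Some (if n == 3 then 0 else if n == 4 then 1 else if n == 5 then 2 else 1).
Proof.
have n_gt0 : 0 < n by apply: leq_trans n_ge3.
(* Reduction modulo [n] only makes [v] total; it is evaluated below [n]. *)
pose v k : cycle_graph n_ge3 := Ordinal (ltn_pmod k n_gt0).
have vE k : k < n -> v k = k :> nat by move=> kn; rewrite /= modn_small.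
have v_edge k : k.+1 < n -> [set v k; v k.+1] \in edges (cycle_graph n_ge3).
  by move=> kn; apply: cycle_edge; rewrite !vE // ltnW.
have v_last k : k.+1 = n -> [set v k; v 0] \in edges (cycle_graph n_ge3).
  by move=> kn; apply: cycle_last_edge; rewrite ?vE // -kn.
have v_uniq k : k <= n -> uniq (map v (iota 0 k)).
  move=> kn; rewrite map_inj_in_uniq ?iota_uniq // => i j; rewrite !mem_iota => ik jk ij.
  have : v i = v j :> nat by rewrite ij.
  by rewrite !vE //; lia.
apply: forcing_timeE => [|T forced].
- apply: wins_can_force; case: eqP => [n3|n3].
    left; apply/subgraph_K3P; exists (v 0), (v 1), (v 2).
    by split; [apply: v_edge | rewrite setUC; apply: v_last | apply: v_edge]; lia.
  case: eqP => [n4|n4].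
    apply: (@wins_C4 _ (v 0) (v 1) (v 2) (v 3));
      [apply: (v_uniq 4) | apply: v_edge | apply: v_edge | apply: v_edge | apply: v_last]; lia.
  case: eqP => [n5|n5].
    apply: (@wins_C5 _ (v 0) (v 1) (v 2) (v 3) (v 4));
      [apply: (v_uniq 5) | apply: v_edge | apply: v_edge | apply: v_edge | apply: v_edge
       | apply: v_last]; lia.
  apply: (@wins_P6 _ (v 0) (v 1) (v 2) (v 3) (v 4) (v 5));
    [apply: (v_uniq 6) | apply: v_edge | apply: v_edge | apply: v_edge | apply: v_edge
     | apply: v_edge]; lia.
(* Triangle-freeness gives [T > 0], which settles every n other than 3 and 5; for n = 5 it remains
   to exclude [T = 1]. *)
- case: eqP => // /eqP n3; have tf := @cycle_triangle_free n n_ge3 n3.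
  have T_gt0 : 0 < T by case: T forced => // /can_force0.
  case: ifP => // _; case: eqP => // n5; rewrite ltn_neqAle T_gt0 andbT.
  apply/eqP=> T1; rewrite -T1 in forced.
  have [//|[m win]] := can_force1 forced isT.
  move: m win; clear - n5; subst n.
  (* The graph carries the proof [n_ge3], which must become [isT] to match the 5-cycle already
     treated. *)
  by rewrite (bool_irrelevance n_ge3 isT) => m; exact: C5_not_forced.
Qed.
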